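(* The exponent $3/4$ in the inequality $$\frac{\xi_2-\xi_1}{(1+\xi_2^2)^{3/4}(1+\xi_1^2)^{3/4}}\leq\frac{\xi_2}{\sqrt{1+\xi_2^2}}-\frac{\xi_1}{\sqrt{1+\xi_1^2}},\qquad \xi_2\geq\xi_1,$$ is optimal, in the following sense: for every real $\alpha<3/4$ and every constant $1\leq C<+\infty$, it is not true that $$\frac{\xi_2-\xi_1}{(1+\xi_2^2)^{\alpha}(1+\xi_1^2)^{\alpha}}\leq C\left(\frac{\xi_2}{\sqrt{1+\xi_2^2}}-\frac{\xi_1}{\sqrt{1+\xi_1^2}}\right)$$ holds for all real $\xi_1,\xi_2$ with $\xi_2\geq\xi_1$.
   Context: The displayed inequality with exponent $3/4$ (and constant $1$) is known to hold for all real $\xi_2\geq\xi_1$; the proposition concerns only the impossibility of lowering the exponent. *)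

(* Defs.v *)
From Stdlib Require Export Reals.

(* Main.v *)
Require Import Defs.
From Stdlib Require Import Reals Lra.
Open Scope R_scope.

(** Test the inequality on the pairs [(x, 2 x)] with [x] large.  Both points lie
    where [u / sqrt (1 + u^2)] is already within [O(x^-2)] of its limit 1
    ([increment_le_inv_sq]), so the right-hand side is at most [C / x^2].  The
    left-hand side is at least of order [x^(1 - 4 b)] with [b = max alpha 0], the
    product of the two weights being at most [(10 x^4)^b] ([weights_le]).  Hence
    [x^3 <= C (10 x^4)^b] for all large [x]; on the logarithmic scale [t = ln x]
    this reads [(3 - 4 b) t <= ln C + b ln 10], and it fails for large [t]
    because [4 b < 3]. *)

(** With [s = sqrt (1 + x^2)] and [(s - x) (s + x) = 1], the gap [1 - x / s] is
    [1 / (s (s + x))]; the value at [y] enters only through the bound 1. *)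
Lemma increment_le_inv_sq (x y : R) :
  0 < x -> y / sqrt (1 + y ^ 2) - x / sqrt (1 + x ^ 2) <= / x ^ 2.
Proof.
  intros Hx.
  assert (Hy1 : y / sqrt (1 + y ^ 2) <= 1).
  { assert (Hs : 0 < sqrt (1 + y ^ 2)) by (apply sqrt_lt_R0; nra).
    assert (Hss : sqrt (1 + y ^ 2) * sqrt (1 + y ^ 2) = 1 + y ^ 2)
      by (apply sqrt_sqrt; nra).
    apply Rmult_le_reg_r with (1 := Hs).
    replace (y / sqrt (1 + y ^ 2) * sqrt (1 + y ^ 2)) with y by (field; lra).
    nra. }
  assert (Hs : 0 < sqrt (1 + x ^ 2)) by (apply sqrt_lt_R0; nra).
  assert (Hss : sqrt (1 + x ^ 2) * sqrt (1 + x ^ 2) = 1 + x ^ 2)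
    by (apply sqrt_sqrt; nra).
  set (s := sqrt (1 + x ^ 2)) in *.
  assert (Hxs : x < s) by nra.
  assert (Hgap : 1 - x / s = / (s * (s + x))).
  { apply Rmult_eq_reg_r with (s * (s + x)); [ | nra].
    rewrite Rinv_l by nra.
    replace ((1 - x / s) * (s * (s + x))) with (s * s - x ^ 2) by (field; lra).
    lra. }
  assert (/ (s * (s + x)) <= / x ^ 2) by (apply Rinv_le_contravar; nra).
  lra.
Qed.

(** The exponent is replaced by its positive part because the weights increase
    with the exponent (their bases are at least 1), whereas they increase with
    the base only for a nonnegative exponent. *)
Lemma weights_le (alpha x : R) :
  1 <= x ->
  Rpower (1 + (2 * x) ^ 2) alpha * Rpower (1 + x ^ 2) alpha
  <= Rpower (10 * x ^ 4) (Rmax alpha 0).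
Proof.
  intros Hx.
  assert (Hx2 : 1 <= x ^ 2) by nra.
  rewrite <- Rpower_mult_distr by nra.
  apply Rle_trans with
    (Rpower (1 + (2 * x) ^ 2) (Rmax alpha 0) * Rpower (1 + x ^ 2) (Rmax alpha 0)).
  - apply Rmult_le_compat; try (left; apply exp_pos);
      apply Rle_Rpower; try nra; apply Rmax_l.
  - rewrite !Rpower_mult_distr by nra.
    apply Rle_Rpower_l; [apply Rmax_r | ].
    split; [nra | ].
    replace (10 * x ^ 4) with ((5 * x ^ 2) * (2 * x ^ 2)) by ring.
    apply Rmult_le_compat; nra.
Qed.

Theorem proposition1p3 :
  forall alpha C : R,
    alpha < 3 / 4 ->
    1 <= C ->
    ~ (forall xi1 xi2 : R,
         xi1 <= xi2 ->
         (xi2 - xi1) /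
           (Rpower (1 + xi2 ^ 2) alpha * Rpower (1 + xi1 ^ 2) alpha)
         <= C * (xi2 / sqrt (1 + xi2 ^ 2) - xi1 / sqrt (1 + xi1 ^ 2))).
Proof.
  intros alpha C Ha HC H.
  set (b := Rmax alpha 0).
  assert (Hb0 : 0 <= b) by apply Rmax_r.
  assert (Hb : b < 3 / 4) by (apply Rmax_lub_lt; lra).
  assert (HlnC : 0 <= ln C)
    by (rewrite <- ln_1; destruct HC as [HC | <-]; [left; apply ln_increasing | ]; lra).
  assert (Hln10 : 0 < ln 10) by (rewrite <- ln_1; apply ln_increasing; lra).
  (* The value of [t] makes [(3 - 4 b) t] exceed [ln C + b ln 10], as [b < 1]. *)
  set (t := (ln C + ln 10 + 1) / (3 - 4 * b)).
  assert (Ht : (3 - 4 * b) * t = ln C + ln 10 + 1) by (unfold t; field; lra).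
  assert (Ht0 : 0 < t) by nra.
  set (x := exp t).
  assert (Hx1 : 1 <= x) by (unfold x; rewrite <- exp_0; left; apply exp_increasing, Ht0).
  specialize (H x (2 * x) ltac:(lra)).
  pose proof (increment_le_inv_sq x (2 * x) ltac:(lra)) as Hinc.
  pose proof (weights_le alpha x Hx1) as HW.
  fold b in HW.
  set (W := Rpower (1 + (2 * x) ^ 2) alpha * Rpower (1 + x ^ 2) alpha) in *.
  assert (HW0 : 0 < W) by (apply Rmult_lt_0_compat; apply exp_pos).
  assert (Hx2 : 0 < x ^ 2) by nra.
  assert (Hmain : x ^ 3 <= C * Rpower (10 * x ^ 4) b).
  { apply Rle_trans with (C * W); [ | apply Rmult_le_compat_l; lra].
    assert (H1 : (2 * x - x) / W <= C * / x ^ 2)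
      by (eapply Rle_trans; [exact H | apply Rmult_le_compat_l; lra]).
    apply Rmult_le_compat_r with (r := W * x ^ 2) in H1; [ | nra].
    replace ((2 * x - x) / W * (W * x ^ 2)) with (x ^ 3) in H1 by (field; lra).
    replace (C * / x ^ 2 * (W * x ^ 2)) with (C * W) in H1 by (field; lra).
    exact H1. }
  assert (Hx3 : 0 < x ^ 3) by (apply pow_lt; lra).
  assert (Hx4 : 0 < x ^ 4) by (apply pow_lt; lra).
  assert (Hlog : ln (x ^ 3) <= ln (C * Rpower (10 * x ^ 4) b)).
  { destruct Hmain as [Hlt | ->]; [left; apply ln_increasing | ]; lra. }
  rewrite ln_mult in Hlog by (try apply exp_pos; lra).
  unfold Rpower in Hlog.
  rewrite ln_exp, ln_mult, !ln_pow in Hlog by lra.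
  unfold x in Hlog.
  rewrite ln_exp in Hlog.
  simpl INR in Hlog.
  nra.
Qed.
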